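(* Let $q$ be a probability density on $\mathbb{R}$, let $x_0\in\mathbb{R}$, and consider the innovation densities $q(x,\cdot)=q(\cdot)$ not depending on $x$ and the drift $m(x)\equiv1$. Put $\sigma^2=\int_{\mathbb{R}} y^2q(y)\,dy$, $\sigma>0$, and $\mu_3=\int_{\mathbb{R}}y^3q(y)\,dy$. Let $h=h_n>0$ and $k=k_n\in\mathbb{N}$ be sequences. Assume: (i) $\int_{\mathbb{R}} y\,q(y)\,dy=0$. (ii) There are constants $\sigma_\star,\sigma^\star>0$ with $\sigma_\star\le\sigma^2\le\sigma^\star$. (iii) There exist an integer $S'>1$ and a function $\psi:\mathbb{R}\to[0,\infty)$ with $\sup_y\psi(y)<\infty$ and $\int_{\mathbb{R}}|y|^S\psi(y)\,dy<\infty$, $S=2S'+4$, such that $|D_y^\nu q(y)|\le\psi(y)$ for all $y\in\mathbb{R}$, $0\le\nu\le4$; moreover, for a constant $C<\infty$, the $j$-fold convolution $q^{(j)}$ of $q$ satisfies $|q^{(j)}(y)|\le Cj^{-1/2}\psi(j^{-1/2}y)$ for all $y\in\mathbb{R}$, $j\ge1$. (iv) There exist $\varkappa<\frac15$ and a constant $C>0$ with $C^{-1}k^{-\varkappa}<hk<C$. Suppose that $nk^{-1}\to c$ for a constant $c\ne0$, that $\mu_3\neq0$, and that $kh\to0$. Let $P_h$ and $Q_h$ be the laws on $\mathbb{R}^n$ of the Markov chain and of the diffusion defined in the context, observed at times $kh,2kh,\ldots,nkh$. Then $\|P_h-Q_h\|_1$ does not converge to zero as $n\to\infty$.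
   Context: Asymptotics: all limits are for $n\to\infty$ with $h=h_n\to0$, $k=k_n$; $q$, $x_0$ do not depend on $n$. Markov chain: $X_{0,h}=x_0$ and $X_{l+1,h}=X_{l,h}+h+\sqrt{h}\,\xi_{l+1,h}$, $l=0,\ldots,nk-1$, where the conditional distribution of $\xi_{l+1,h}$ given $X_{l,h},\ldots,X_{0,h}$ has density $q(\cdot)$. $P_h$ is the joint distribution of $(X_{k,h},X_{2k,h},\ldots,X_{nk,h})$. Diffusion: $dY_s=ds+\sigma\,dW_s$, $Y_0=x_0$, with $W$ a standard Wiener process. $Q_h$ is the joint distribution of $(Y_{kh},Y_{2kh},\ldots,Y_{nkh})$. $\|\cdot\|_1$ is the total variation of a signed measure, i.e. the $L_1$-distance $\|P-Q\|_1=\int|dP-dQ|$. *)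

(* Defs.v *)
(* MathComp-Analysis *)
From HB Require Import structures.
From mathcomp Require Import all_boot all_order all_algebra.
From mathcomp Require Import all_classical all_reals all_analysis.
Set Implicit Arguments.
Unset Strict Implicit.
Unset Printing Implicit Defensive.
Import Order.TTheory GRing.Theory Num.Theory.
Import numFieldNormedType.Exports.
Local Open Scope classical_set_scope.
Local Open Scope ring_scope.

Definition is_density (R : realType) (q : R -> R) : Prop :=
  [/\ measurable_fun setT q, (forall y, 0 <= q y) &
      (\int[lebesgue_measure]_y (q y)%:E = 1)%E].

Definition convolution (R : realType) (f g : R -> R) (y : R) : R :=
  \int[lebesgue_measure]_z (f (y - z) * g z).

(* Meaningful for 1 <= j only; the value at j = 0 is junk (it equals q). *)
Definition conv_power (R : realType) (q : R -> R) (j : nat) : R -> R :=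
  iter j.-1 (fun f => convolution f q) q.

(* The sigma-algebra sigma(Z_i, i in D), as a family of subsets of T. *)
Definition sigma_generated (R : realType) d (T : measurableType d) (I : Type)
    (D : set I) (Z : I -> T -> R) : set (set T) :=
  <<s \bigcup_(i in D) preimage_set_system setT (Z i) measurable >>.

(* p w is a density of the regular conditional distribution of xi given the
   sigma-algebra F. *)
Definition has_conditional_density (R : realType) d (T : measurableType d)
    (P : probability T R) (F : set (set T)) (xi : T -> R) (p : T -> R -> R)
    : Prop :=
  forall A B, F A -> measurable B ->
    (P (A `&` xi @^-1` B) =
      \int[P]_(w in A) \int[lebesgue_measure]_(y in B) (p w y)%:E)%E.

(* X 0, ..., X N is the chain with unit drift, step h, start x0 and innovations
   xi 1, ..., xi N of conditional density q; other indices are unconstrained. *)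
Definition is_chain (R : realType) d (T : measurableType d)
    (P : probability T R) (q : R -> R) (x0 h : R) (N : nat)
    (X xi : nat -> {RV P >-> R}) : Prop :=
  [/\ forall w, X 0%N w = x0,
      forall l w, (l < N)%N ->
        X l.+1 w = X l w + h + Num.sqrt h * xi l.+1 w &
      forall l, (l < N)%N ->
        has_conditional_density P
          (sigma_generated [set i | (i <= l)%N] (fun i => X i : T -> R))
          (xi l.+1) (fun=> q)].

(* Only the times t >= 0 matter.  The second argument of normal_prob is the
   standard deviation. *)
Definition is_wiener (R : realType) d (T : measurableType d)
    (P : probability T R) (W : R -> {RV P >-> R}) : Prop :=
  [/\ {ae P, forall w, W 0 w = 0},
      forall s t (B : set R), 0 <= s -> s < t -> measurable B ->
        P [set w | B (W t w - W s w)] = normal_prob 0 (Num.sqrt (t - s)) B,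
      forall s t (A : set T) (B : set R), 0 <= s -> s < t ->
        sigma_generated [set u | 0 <= u <= s] (fun u => W u : T -> R) A ->
        measurable B ->
        P (A `&` [set w | B (W t w - W s w)]) =
          (P A * P [set w | B (W t w - W s w)%R])%E &
      {ae P, forall w, {within `[0, +oo[, continuous (fun t => W t w)}}].

(* dY = ds + sigma dW, Y_0 = x0, in integrated form: the coefficients are
   constant, so the stochastic integral of sigma is sigma * W. *)
Definition is_diffusion (R : realType) d (T : measurableType d)
    (P : probability T R) (x0 sigma : R) (W Y : R -> {RV P >-> R}) : Prop :=
  {ae P, forall w, forall s, 0 <= s -> Y s w = x0 + s + sigma * W s w}.

Definition rv_tuple (R : realType) d (T : measurableType d)
    (P : probability T R) (n : nat) (Z : 'I_n -> {RV P >-> R}) (w : T)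
    : n.-tuple R :=
  [tuple Z i w | i < n].

Lemma measurable_rv_tuple (R : realType) d (T : measurableType d)
    (P : probability T R) (n : nat) (Z : 'I_n -> {RV P >-> R}) :
  measurable_fun setT (rv_tuple Z).
Proof.
apply/measurable_fun_tnthP => i.
rewrite (_ : _ \o _ = Z i); first exact: measurable_funPT.
by apply/funext => w /=; rewrite tnth_mktuple.
Qed.

HB.instance Definition _ (R : realType) d (T : measurableType d)
    (P : probability T R) (n : nat) (Z : 'I_n -> {RV P >-> R}) :=
  isMeasurableFun.Build _ _ T (n.-tuple R) (rv_tuple Z)
    (measurable_rv_tuple Z).

Definition joint_law (R : realType) d (T : measurableType d)
    (P : probability T R) (n : nat) (Z : 'I_n -> {RV P >-> R})
    : probability (n.-tuple R) R :=
  distribution P (rv_tuple Z).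

Definition charge_sub (R : realType) d (T : measurableType d)
    (P Q : probability T R) : {charge set T -> \bar R} :=
  cadd (charge_of_finite_measure P) (copp (charge_of_finite_measure Q)).

(* Total mass nu^+(T) + nu^-(T) of the variation of nu; it does not depend on
   the chosen Hahn decomposition. *)
Definition total_variation_norm (R : realType) d (T : measurableType d)
    (nu : {charge set T -> \bar R}) : \bar R :=
  let pos := cid (Hahn_decomposition nu) in
  let neg := cid (svalP pos) in
  charge_variation (svalP neg) setT.

Definition L1_distance (R : realType) d (T : measurableType d)
    (P Q : probability T R) : \bar R :=
  total_variation_norm (charge_sub P Q).

(* Main.v *)
(** Both laws have independent increments: after centring, those of the chain
  are sqrt h times sums of k innovations, those of the diffusion are centred
  normal.  Take as test statistic the normalised sum of cubes
  T = (n k^3 h^3)^(-1/2) sum_i D_i^3 of the centred increments D_i.  Under the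
  diffusion E T = 0 by symmetry; under the chain the third cumulant is additive,
  so E T = sqrt (n / k) mu3 exactly, which tends to sqrt c mu3 <> 0.  Sixth
  moments keep E T^2 bounded under both laws.  Two laws whose second moments of
  T are at most K satisfy |E T - E' T| <= 2K/M + 2M ||P - Q||_1 for every M
  (truncate T at M), so the distance cannot vanish. *)
Require Import Defs.
From HB Require Import structures.
From mathcomp Require Import all_boot all_order all_algebra.
From mathcomp Require Import all_classical all_reals all_analysis.
From mathcomp Require Import measurable_realfun ring lra zify.
Set Implicit Arguments.
Unset Strict Implicit.
Unset Printing Implicit Defensive.
Import Order.TTheory GRing.Theory Num.Theory.
Import numFieldNormedType.Exports.
Local Open Scope classical_set_scope.
Local Open Scope ring_scope.

(** * Expectations of real random variables *)

Section mean.
Context d (T : measurableType d) (R : realType) (P : probability T R).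
Implicit Types (f g : T -> R) (a b c : R).

(** Integrability is bundled with a real value, so that sums and differences of means never meet
    infinite integrals. *)
Definition has_mean f a : Prop :=
  P.-integrable setT (EFin \o f) /\ (\int[P]_w (f w)%:E = a%:E)%E.

Lemma has_mean_cst c : has_mean (cst c) c.
Proof.
split; first exact: finite_measure_integrable_cst.
rewrite [LHS](_ : _ = \int[P]_w (cst c%:E w))%E//.
by rewrite integral_cst//= [X in (_ * X)%E]probability_setT mule1.
Qed.

Lemma has_meanD f g a b :
  has_mean f a -> has_mean g b -> has_mean (fun w => f w + g w) (a + b).
Proof.
move=> [fi fa] [gi gb]; split; first exact: (integrableD _ fi gi).
by rewrite EFinD -fa -gb -integralD_EFin.
Qed.

Lemma has_meanZ c f a : has_mean f a -> has_mean (fun w => c * f w) (c * a).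
Proof.
move=> [fi fa]; split; first exact: (integrableZl _ c fi).
by rewrite EFinM -fa -integralZl.
Qed.

Lemma has_meanB f g a b :
  has_mean f a -> has_mean g b -> has_mean (fun w => f w - g w) (a - b).
Proof.
move=> fa /(has_meanZ (-1)) /(has_meanD fa).
by under eq_fun do rewrite mulN1r; rewrite mulN1r.
Qed.

Lemma has_mean_sum n (F : 'I_n -> T -> R) (a : 'I_n -> R) :
  (forall i, has_mean (F i) (a i)) ->
  has_mean (fun w => \sum_(i < n) F i w) (\sum_(i < n) a i).
Proof.
elim: n F a => [|n IHn] F a Fa.
  by rewrite big_ord0; under eq_fun do rewrite big_ord0; exact: has_mean_cst.
rewrite big_ord_recl; under eq_fun do rewrite big_ord_recl.
by apply: has_meanD => //; exact: IHn.
Qed.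

Lemma has_mean_le f g a b :
  has_mean f a -> has_mean g b -> (forall w, f w <= g w) -> a <= b.
Proof.
move=> [fi fa] [gi gb] fg; rewrite -lee_fin -fa -gb.
by apply: le_integral => // w _; rewrite lee_fin.
Qed.

(** Serves to pass from the Wiener increments to those of the diffusion, which agree only almost
    surely. Measurability of [g] is assumed because [P] need not be complete. *)
Lemma has_mean_ae f g a : measurable_fun setT g ->
  {ae P, forall w, f w = g w} -> has_mean f a -> has_mean g a.
Proof.
move=> mg fg [fi fa].
have mf : measurable_fun setT (EFin \o f) by exact: (measurable_int P fi).
have mg' : measurable_fun setT (EFin \o g) by exact/measurable_EFinP.
have fgE : ae_eq P setT (EFin \o f) (EFin \o g).
  by apply: filterS fg => w /= -> _.
split; last first.
  by rewrite -fa; apply: ae_eq_integral => //; exact: ae_eq_sym.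
apply/integrableP; split=> //.
have /integrableP[_ ltfoo] := fi.
rewrite (le_lt_trans _ ltfoo)// le_eqVlt; apply/orP; left; apply/eqP.
apply: ae_eq_integral => //; [exact: measurableT_comp..|].
by apply: filterS fg => w /= ->.
Qed.

Lemma has_mean_dominated f g : measurable_fun setT f ->
  P.-integrable setT (EFin \o g) -> (forall w, `|f w| <= `|g w|) ->
  P.-integrable setT (EFin \o f).
Proof.
move=> mf gi fg; apply: le_integrable gi => //.
- exact/measurable_EFinP.
- by move=> w _; rewrite lee_fin.
Qed.

Lemma integrable_has_mean f : P.-integrable setT (EFin \o f) ->
  exists a, has_mean f a.
Proof.
move=> fi; have ffin := integrable_fin_num measurableT fi.
by exists (fine (\int[P]_w (f w)%:E)); split => //; rewrite fineK.
Qed.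

End mean.

Lemma has_mean_distribution d d' (T : measurableType d)
    (T' : measurableType d') (R : realType) (P : probability T R)
    (X : {RV P >-> T'}) (g : T' -> R) (a : R) : measurable_fun setT g ->
  has_mean (distribution P X) g a <-> has_mean P (fun w => g (X w)) a.
Proof.
move=> mg; have mg' : measurable_fun setT (EFin \o g) by exact/measurable_EFinP.
have mX : measurable_fun setT X by [].
have gXi : (distribution P X).-integrable setT (EFin \o g) <->
           P.-integrable setT (EFin \o (fun w => g (X w))).
  split => /integrableP[_ gi]; apply/integrableP; split => //.
  - exact/measurable_EFinP/measurableT_comp.
  - by move: gi; rewrite ge0_integral_distribution//; exact: measurableT_comp.
  - by rewrite ge0_integral_distribution//; exact: measurableT_comp.
split=> -[gi ga].
  have gi' := gXi.1 gi; split => //.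
  by rewrite -ga integral_distribution.
by split; [exact/gXi|rewrite integral_distribution].
Qed.

(* Fubini on the law of (U, V), which is the product of the marginals. *)
Lemma has_meanM_indep d (T : measurableType d) (R : realType)
    (P : probability T R) (U V : {RV P >-> R}) (a b : R) :
  (forall A B, measurable A -> measurable B ->
    P (U @^-1` A `&` V @^-1` B) = P (U @^-1` A) * P (V @^-1` B))%E ->
  has_mean P U a -> has_mean P V b -> has_mean P (fun w => U w * V w) (a * b).
Proof.
move=> UV Ua Vb.
pose m1 := distribution P U; pose m2 := distribution P V.
have mUV : measurable_fun setT (fun w => (U w, V w)).
  by apply/measurable_fun_pairP; split.
pose UV' : {RV P >-> (R * R)%type} :=
  mfun_Sub (mem_set mUV).
have prodE : forall A : set (R * R), measurable A ->
    (m1 \x m2)%E A = distribution P UV' A.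
  by apply: product_measure_unique => A B mA mB; rewrite -UV.
have prod_mean : has_mean (distribution P UV') (fun z => z.1 * z.2) (a * b).
  have mf : measurable_fun setT (fun z : R * R => z.1 * z.2).
    by apply: measurable_funM; [exact: measurable_fst|exact: measurable_snd].
  have mf' : measurable_fun setT (EFin \o (fun z : R * R => z.1 * z.2)).
    exact/measurable_EFinP.
  have mid : measurable_fun [set: R] (fun x : R => x) by exact: measurable_id.
  have [idi ida] := (has_mean_distribution U a mid).2 Ua.
  have [idi' idb] := (has_mean_distribution V b mid).2 Vb.
  have fin2 : (\int[m2]_y `|y%:E|)%E \is a fin_num.
    by apply: integrable_fin_num => //; exact: integrable_abse.
  have prodi : (m1 \x m2)%E.-integrable setT
      (EFin \o (fun z : R * R => z.1 * z.2)).
    (* Tonelli: the iterated integral of |x y| is the product of the two first absolute moments,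
       both finite. *)
    apply/integrable12ltyP => //.
    have absE x : (\int[m2]_y `|((x * y)%R)%:E| =
        (fine (\int[m2]_y `|y%:E|))%:E * `|x%:E|)%E.
      rewrite fineK// muleC -ge0_integralZl//; last first.
        by apply: measurableT_comp => //; exact: measurable_int idi.
      by apply: eq_integral => y _; rewrite -EFinM/= normrM.
    under eq_integral do rewrite /= absE.
    rewrite ge0_integralZl//; last 2 first.
    - by apply: measurableT_comp => //; exact: measurable_int idi.
    - by rewrite lee_fin fine_ge0// integral_ge0.
    apply: lte_mul_pinfty; last by have /integrableP[] := idi.
      by rewrite lee_fin fine_ge0// integral_ge0.
    by [].
  split.
    move/integrableP: prodi => [_ prodi]; apply/integrableP; split => //.
    rewrite (eq_measure_integral (m1 \x m2)%E)// => A mA _.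
    exact/esym/prodE.
  rewrite (eq_measure_integral (m1 \x m2)%E); last first.
    by move=> A mA _; exact/esym/prodE.
  rewrite -(integral12_prod_meas1 prodi).
  under eq_integral.
    move=> x _; rewrite /fubini_F/=.
    under eq_integral do rewrite EFinM.
    rewrite integralZl//= idb; over.
  by rewrite /= integralZr//= ida.
have mf : measurable_fun setT (fun z : R * R => z.1 * z.2).
  by apply: measurable_funM; [exact: measurable_fst|exact: measurable_snd].
exact/(has_mean_distribution UV' (a * b) mf).
Qed.

(** * Adaptedness to, and independence of, a generated sigma-algebra *)

Section adapted.
Context d (T : measurableType d) (R : realType) (P : probability T R).
Implicit Types (G : set (set T)) (U : T -> R).

(** [G] is only a generating family; [g_sigma_algebraType G] is the same space [T] carrying the
    sigma-algebra generated by [G]. *)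
Definition adapted G U : Prop :=
  measurable_fun [set: g_sigma_algebraType G] (U : g_sigma_algebraType G -> R).

Definition independent_of G (xi : T -> R) : Prop :=
  forall A B, <<s G >> A -> measurable B ->
    (P (A `&` xi @^-1` B) = P A * P (xi @^-1` B))%E.

Lemma adapted_preimage G U B : adapted G U -> measurable B ->
  <<s G >> (U @^-1` B).
Proof. by move=> GU mB; have := GU measurableT _ mB; rewrite setTI. Qed.

Lemma adapted_sub G G' U : G `<=` <<s G' >> -> adapted G U -> adapted G' U.
Proof.
move=> GG' GU _ B mB; rewrite setTI.
have sub : <<s G >> `<=` <<s G' >>.
  by apply: smallest_sub => //; exact: smallest_sigma_algebra.
apply: sub; exact: adapted_preimage GU mB.
Qed.

Lemma adapted_measurable G U : G `<=` measurable -> adapted G U ->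
  measurable_fun setT U.
Proof.
move=> Gm GU _ B mB; rewrite setTI.
have sub : <<s G >> `<=` @measurable _ T.
  by apply: smallest_sub => //; exact: sigma_algebra_measurable.
apply: sub; exact: adapted_preimage GU mB.
Qed.

(** Events of [U] lie in the sigma-algebra of [G] and events of [g xi] are events of [xi], so the
    two factors are independent. *)
Lemma has_meanM_adapted G U (xi : {RV P >-> R}) (g : R -> R) (a b : R) :
  G `<=` measurable -> adapted G U -> independent_of G xi ->
  measurable_fun setT g -> has_mean P U a -> has_mean P (fun w => g (xi w)) b ->
  has_mean P (fun w => U w * g (xi w)) (a * b).
Proof.
move=> Gm GU indep mg Ua gb.
have mU := adapted_measurable Gm GU.
have mgxi : measurable_fun setT (fun w => g (xi w)) by exact: measurableT_comp.
pose U' : {RV P >-> R} := mfun_Sub (mem_set mU).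
pose V' : {RV P >-> R} := mfun_Sub (mem_set mgxi).
apply: (@has_meanM_indep _ _ _ P U' V') => // A B mA mB.
have mgB : measurable (g @^-1` B) by rewrite -[X in measurable X]setTI; exact: mg.
rewrite (_ : V' @^-1` B = xi @^-1` (g @^-1` B))//.
by rewrite indep//; exact: adapted_preimage.
Qed.

End adapted.

(** * Moments of sums of independent or uncorrelated variables *)

(* The r-th moment of a sum of m independent variables whose i-th moments are
   mu i, computed by the binomial expansion of the last step. *)
Fixpoint sum_moment (R : realType) (mu : nat -> R) (m r : nat) : R :=
  if m is m'.+1 then
    \sum_(i < r.+1) 'C(r, i)%:R * (sum_moment mu m' (r - i) * mu i)
  else (r == 0%N)%:R.

(** Induction on the number of steps: the last innovation is independent of everything before it.
    The weight [U], known before the walk starts, is carried along so that one statement yields both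
    the moments of a block ([U] = 1) and its products with functions of the past. *)
Lemma has_mean_random_walk d (T : measurableType d) (R : realType)
    (P : probability T R) (M N : nat) (G : nat -> set (set T))
    (S : nat -> T -> R) (xi : nat -> {RV P >-> R}) (mu : nat -> R)
    (U : T -> R) (u : R) :
  (forall m, G m `<=` measurable) ->
  (forall m, adapted (G m) U) ->
  (forall m, (m <= M)%N -> adapted (G m) (S m)) ->
  (forall m, (m < M)%N -> independent_of P (G m) (xi m)) ->
  (forall w, S 0%N w = 0) ->
  (forall m w, (m < M)%N -> S m.+1 w = S m w + xi m w) ->
  (forall m i, (m < M)%N -> (i <= N)%N ->
    has_mean P (fun w => xi m w ^+ i) (mu i)) ->
  has_mean P U u ->
  forall m r, (m <= M)%N -> (r <= N)%N ->
    has_mean P (fun w => U w * S m w ^+ r) (u * sum_moment mu m r).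
Proof.
move=> Gm GU GS indep S0 SS ximu Uu; elim=> [|m IHm] r mM rN /=.
  under eq_fun do rewrite S0 expr0n mulrC.
  by rewrite mulrC; exact: has_meanZ.
(* The binomial terms are grouped as an adapted factor times a power of the new innovation. *)
rewrite (_ : (fun w => _) = fun w => \sum_(i < r.+1)
    'C(r, i)%:R * ((U w * S m w ^+ (r - i)) * xi m w ^+ i)); last first.
  apply/funext => w; rewrite SS// exprDn mulr_sumr; apply: eq_bigr => i _.
  by rewrite -mulr_natl; ring.
rewrite (_ : u * _ = \sum_(i < r.+1)
    'C(r, i)%:R * ((u * sum_moment mu m (r - i)) * mu i)); last first.
  by rewrite mulr_sumr; apply: eq_bigr => i _; ring.
apply: has_mean_sum => i; apply: has_meanZ.
have iN : (i <= N)%N by rewrite (leq_trans _ rN)// -ltnS.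
apply: (@has_meanM_adapted _ _ _ P (G m) (fun w => U w * S m w ^+ (r - i))
  (xi m) (fun x => x ^+ i)) => //.
- by apply: measurable_funM; [exact: GU|apply: measurable_funX; exact: GS (ltnW mM)].
- exact: indep.
- by apply: IHm; [exact: ltnW|exact: leq_trans (leq_subr _ _) rN].
- exact: ximu.
Qed.

Section sum_moment.
Variables (R : realType) (mu : nat -> R).
Hypotheses (mu0 : mu 0%N = 1) (mu1 : mu 1%N = 0).

Let simp := (big_ord_recr, big_ord0, mu0, mu1).

Lemma sum_moment0 m : sum_moment mu m 0 = 1.
Proof. by elim: m => //= m IHm; rewrite !simp/= subnn IHm bin0; ring. Qed.

Lemma sum_moment1 m : sum_moment mu m 1 = 0.
Proof.
elim: m => //= m IHm; rewrite !simp/= !(subn0, subnn) IHm sum_moment0; ring.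
Qed.

Lemma sum_moment2 m : sum_moment mu m 2 = m%:R * mu 2.
Proof.
elim: m => [|m IHm] /=; first by rewrite mul0r.
rewrite !simp/= !(subn0, subnn) IHm sum_moment0 -natr1 !binE; ring.
Qed.

(** For centred variables the third moment is the third cumulant, hence additive: every mixed term
    contains a first moment. *)
Lemma sum_moment3 m : sum_moment mu m 3 = m%:R * mu 3.
Proof.
elim: m => [|m IHm] /=; first by rewrite mul0r.
rewrite !simp/= !(subn0, subnn) IHm sum_moment0 sum_moment1 -natr1 !binE; ring.
Qed.

Lemma sum_moment4 m :
  sum_moment mu m 4 = m%:R * mu 4 + 3 * m%:R * (m%:R - 1) * mu 2 ^+ 2.
Proof.
elim: m => [|m IHm] /=; first by rewrite !(mulr0, mul0r) addr0.
rewrite !simp/= !(subn0, subnn) IHm sum_moment0 sum_moment1 sum_moment2.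
by rewrite -natr1 !binE; ring.
Qed.

(** The terms correspond to the partitions of six factors into blocks without singletons: 1 of type
    6, 15 of type 4+2, 10 of type 3+3, 15 of type 2+2+2. Distinct blocks receive distinct summands,
    whence the falling factorials of m. *)
Lemma sum_moment6 m : sum_moment mu m 6 =
  m%:R * mu 6 + 15 * m%:R * (m%:R - 1) * mu 4 * mu 2 +
  10 * m%:R * (m%:R - 1) * mu 3 ^+ 2 +
  15 * m%:R * (m%:R - 1) * (m%:R - 2) * mu 2 ^+ 3.
Proof.
elim: m => [|m IHm] /=; first by rewrite !(mulr0, mul0r) !addr0.
rewrite !simp/= !(subn0, subnn) IHm sum_moment0 sum_moment1 sum_moment2.
by rewrite sum_moment3 sum_moment4 -natr1 !binE; ring.
Qed.

(** Cubic growth is exactly what the factor k^3 in the normalisation of the statistic absorbs. *)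
Lemma sum_moment6_le m : sum_moment mu m 6 <=
  (`|mu 6| + 15 * `|mu 4 * mu 2| + 10 * mu 3 ^+ 2 + 15 * `|mu 2 ^+ 3|) *
  m%:R ^+ 3.
Proof.
rewrite sum_moment6; case: m => [|m].
  by rewrite !(mul0r, mulr0) !addr0 expr0n mulr0.
rewrite -natr1; set x : R := m%:R; have x0 : 0 <= x by rewrite ler0n.
(* With m = x + 1 each falling factorial is a polynomial in x >= 0 between -(x + 1)^3 and (x + 1)^3.
   Both sides are bounded because the moments may have either sign here. *)
have le (a y : R) : - (x + 1) ^+ 3 <= y <= (x + 1) ^+ 3 ->
    y * a <= `|a| * (x + 1) ^+ 3.
  move=> xy; rewrite mulrC (le_trans (ler_norm _))// normrM.
  by rewrite ler_wpM2l// ler_norml.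
have x2 : 0 <= x ^+ 2 by exact: sqr_ge0.
have x3 : 0 <= x ^+ 3 by exact: exprn_ge0.
have cubeE : (x + 1) ^+ 3 = x ^+ 3 + 3 * x ^+ 2 + 3 * x + 1 by ring.
have le6 : (x + 1) * mu 6 <= `|mu 6| * (x + 1) ^+ 3.
  by apply: le; rewrite cubeE; apply/andP; split; lra.
have le4 : (x ^+ 2 + x) * (mu 4 * mu 2) <= `|mu 4 * mu 2| * (x + 1) ^+ 3.
  by apply: le; rewrite cubeE; apply/andP; split; lra.
have le3 : (x ^+ 2 + x) * mu 3 ^+ 2 <= `|mu 3 ^+ 2| * (x + 1) ^+ 3.
  by apply: le; rewrite cubeE; apply/andP; split; lra.
have le2 : (x ^+ 3 - x) * mu 2 ^+ 3 <= `|mu 2 ^+ 3| * (x + 1) ^+ 3.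
  by apply: le; rewrite cubeE; apply/andP; split; lra.
rewrite (ger0_norm (sqr_ge0 (mu 3))) in le3.
move: le6 le4 le3 le2; rewrite -subr_ge0 => le6; rewrite -subr_ge0 => le4.
rewrite -subr_ge0 => le3; rewrite -subr_ge0 => le2; rewrite -subr_ge0.
have := addr_ge0 (addr_ge0 le6 (mulr_ge0 (ler0n R 15) le4))
  (addr_ge0 (mulr_ge0 (ler0n R 10) le3) (mulr_ge0 (ler0n R 15) le2)).
by congr (0 <= _); ring.
Qed.

End sum_moment.

(** Expanding the square at the last term leaves one cross term, which the third hypothesis
    factorises. That hypothesis allows any mean [v] of the partial sum; its value n m comes from the
    induction. *)
Lemma has_mean_uncorrelated_sum d (T : measurableType d) (R : realType)
    (P : probability T R) (n : nat) (Z : nat -> T -> R) (m s : R) :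
  (forall i, (i < n)%N -> has_mean P (Z i) m) ->
  (forall i, (i < n)%N -> has_mean P (fun w => Z i w ^+ 2) s) ->
  (forall i v, (i < n)%N -> has_mean P (fun w => \sum_(j < i) Z j w) v ->
    has_mean P (fun w => (\sum_(j < i) Z j w) * Z i w) (v * m)) ->
  has_mean P (fun w => \sum_(j < n) Z j w) (n%:R * m) /\
  has_mean P (fun w => (\sum_(j < n) Z j w) ^+ 2)
    (n%:R * s + n%:R * (n%:R - 1) * m ^+ 2).
Proof.
elim: n => [|n IHn] Zm Zs VZ.
  rewrite !mul0r addr0; split.
    by under eq_fun do rewrite big_ord0; exact: has_mean_cst.
  by under eq_fun do rewrite big_ord0 expr0n; exact: has_mean_cst.
have [Vm Vs] : _ /\ _ := IHn (fun i ni => Zm i (ltnW ni))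
  (fun i ni => Zs i (ltnW ni)) (fun i v ni => VZ i v (ltnW ni)).
split.
  under eq_fun do rewrite big_ord_recr/=.
  by rewrite -natr1 mulrDl mul1r; exact: has_meanD (Zm _ _).
rewrite (_ : (fun w => _) = fun w => (\sum_(j < n) Z j w) ^+ 2 +
    (2 * ((\sum_(j < n) Z j w) * Z n w) + Z n w ^+ 2)); last first.
  by apply/funext => w; rewrite big_ord_recr/=; ring.
rewrite (_ : _ + _ = (n%:R * s + n%:R * (n%:R - 1) * m ^+ 2) +
    (2 * ((n%:R * m) * m) + s)); last by rewrite -natr1; ring.
apply: has_meanD => //; apply: has_meanD; last exact: Zs.
by apply: has_meanZ; exact: VZ.
Qed.

(** * Expectations under a law with a Lebesgue density *)

Section density.
Context (R : realType) (nu : probability (measurableTypeR R) R) (p : R -> R).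
Local Notation lambda := (@lebesgue_measure R).
Hypotheses (mp : measurable_fun setT p) (p0 : forall y, 0 <= p y).
Hypothesis nup :
  forall B, measurable B -> (nu B = \int[lambda]_(y in B) (p y)%:E)%E.

(** [p] and the Radon-Nikodym derivative of [nu] have the same integral over every measurable set,
    so they agree almost everywhere, and the change of variables for the derivative applies to
    [p]. *)
Lemma ge0_integral_density (f : R -> \bar R) : measurable_fun setT f ->
  (forall y, 0 <= f y)%E ->
  (\int[nu]_y f y = \int[lambda]_y (f y * (p y)%:E))%E.
Proof.
move=> mf f0.
have mp' : measurable_fun setT (EFin \o p) by exact/measurable_EFinP.
have dom : nu `<< lambda.
  apply/null_content_dominatesP => A mA A0; rewrite nup//.
  by apply: null_set_integral => //; exact: measurable_funTS.
have ip : lambda.-integrable setT (EFin \o p).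
  apply/integrableP; split => //.
  under eq_integral do rewrite /= ger0_norm//.
  by rewrite -nup// (le_lt_trans (probability_le1 _ _))// ltry.
rewrite -(Radon_Nikodym_SigmaFinite.change_of_variables dom)//.
apply: ae_eq_integral => //.
- apply: emeasurable_funM => //.
  exact: measurable_int (Radon_Nikodym_SigmaFinite.f_integrable dom).
- exact: emeasurable_funM.
apply: ae_eqe_mul2l; apply: integral_ae_eq => //.
- exact: Radon_Nikodym_SigmaFinite.f_integrable.
- by move=> A _ mA; rewrite -nup// -Radon_Nikodym_SigmaFinite.f_integral.
Qed.

Lemma has_mean_density (f : R -> R) (a : R) : measurable_fun setT f ->
  lambda.-integrable setT (EFin \o (fun y => f y * p y)) ->
  (\int[lambda]_y (f y * p y)%:E = a%:E)%E ->
  has_mean nu f a.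
Proof.
move=> mf fi fa.
have mf' : measurable_fun setT (EFin \o f) by exact/measurable_EFinP.
have nuf : nu.-integrable setT (EFin \o f).
  apply/integrableP; split => //.
  move/integrableP : fi => [_]; apply: le_lt_trans.
  rewrite ge0_integral_density//; last exact: measurableT_comp.
  rewrite le_eqVlt; apply/orP; left; apply/eqP; apply: eq_integral => y _ /=.
  by rewrite -EFinM normrM (ger0_norm (p0 y)).
split => //; rewrite -fa integralE [RHS]integralE.
congr (_ - _)%E.
- rewrite ge0_integral_density//; last exact: measurable_funepos.
  apply: eq_integral => y _; rewrite !funeposE /=.
  by rewrite maxe_pMl ?lee_fin// mul0e.
- rewrite ge0_integral_density//; last exact: measurable_funeneg.
  apply: eq_integral => y _; rewrite !funenegE /=.
  by rewrite maxe_pMl ?lee_fin// mul0e -EFinM mulNr.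
Qed.

End density.

Lemma has_mean_law d (T : measurableType d) (R : realType)
    (P : probability T R) (xi : {RV P >-> R}) (p f : R -> R) (a : R) :
  measurable_fun setT p -> (forall y, 0 <= p y) ->
  (forall B, measurable B ->
    P (xi @^-1` B) = \int[lebesgue_measure]_(y in B) (p y)%:E)%E ->
  measurable_fun setT f ->
  lebesgue_measure.-integrable setT (EFin \o (fun y => f y * p y)) ->
  (\int[lebesgue_measure]_y (f y * p y)%:E = a%:E)%E ->
  has_mean P (fun w => f (xi w)) a.
Proof.
move=> mp p0 xip mf fi fa.
(* The same map, retyped with values in the space on which the density lemmas are stated. *)
have mxi : measurable_fun setT (xi : T -> measurableTypeR R).
  by move=> mT B mB; exact: (measurable_funPT xi mT B mB).
pose xi' : {RV P >-> measurableTypeR R} :=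
  @mfun_Sub _ _ T (measurableTypeR R) _ (mem_set mxi).
apply: (has_mean_distribution xi' a mf).1.
exact: has_mean_density fi fa.
Qed.

(** * Third and sixth moments of centred normal laws *)

Section normal_moments.
Context (R : realType).
Local Notation lambda := (@lebesgue_measure R).

Lemma integral_lebesgue_oppr (f : R -> R) :
  lambda.-integrable setT (EFin \o f) ->
  (\int[lambda]_x (f (- x))%:E = \int[lambda]_x (f x)%:E)%E.
Proof.
move=> fi.
have mN : measurable_fun [set: measurableTypeR R]
    (-%R : measurableTypeR R -> measurableTypeR R).
  exact: oppr_measurable.
have fE : (fun x => f (- x)) \o -%R = f.
  by apply/funext => x /=; rewrite opprK.
have mf : measurable_fun [set: measurableTypeR R] (EFin \o (fun x => f (- x))).
  exact: (measurableT_comp (measurable_int lambda fi) mN).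
have pushE : (\int[lambda]_x (f (- x))%:E =
    \int[pushforward lambda (-%R : _ -> measurableTypeR R)]_x (f (- x))%:E)%E.
  by apply: eq_measure_integral => //= A mA _; exact/esym/lebesgue_measureN.
rewrite pushE (integral_pushforward mN mf)//.
- by apply: eq_integral => x _ /=; rewrite opprK.
- by rewrite (_ : _ \o _ = EFin \o f)//; apply/funext => x /=; rewrite opprK.
Qed.

(** Cube the inequality u/3 <= 1 + u/3 <= exp(u/3). *)
Lemma expR_ge_cube (u : R) : 0 <= u -> u ^+ 3 <= 27 * expR u.
Proof.
move=> u0; have -> : u = 3%:R * (u / 3) by field.
rewrite mulrC expRM_natr.
have : 1 + u / 3 <= expR (u / 3) by exact: expR_ge1Dx.
set v := u / 3; set e := expR v => ve.
have v0 : 0 <= v by rewrite divr_ge0.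
have ve3 : v ^+ 3 <= e ^+ 3 by rewrite lerXn2r// ?nnegrE ?expR_ge0//; lra.
have -> : (v * 3) ^+ 3 = 27 * v ^+ 3 by ring.
by rewrite ler_pM2l.
Qed.

Lemma normal_fun_sqrt2 (s x : R) : 0 < s ->
  normal_fun 0 s x * expR (x ^+ 2 / (4 * s ^+ 2)) = normal_fun 0 (Num.sqrt 2 * s) x.
Proof.
move=> s0; rewrite /normal_fun -expRD; congr expR.
rewrite subr0 exprMn sqr_sqrtr// -(mulr_natr (s ^+ 2)) -(mulr_natr (2 * _)).
by field; rewrite gt_eqF.
Qed.

Lemma normal_peak_sqrt2 (s : R) :
  normal_peak s = Num.sqrt 2 * normal_peak (Num.sqrt 2 * s).
Proof.
rewrite /normal_peak exprMn sqr_sqrtr//.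
have -> : 2 * s ^+ 2 * pi *+ 2 = 2 * (s ^+ 2 * pi *+ 2) by ring.
rewrite sqrtrM// invfM mulrA.
by rewrite divff ?mul1r// gt_eqF// sqrtr_gt0.
Qed.

(* With u = x^2 / (4 s^2), x^6 = 64 s^6 u^3 and u^3 <= 27 exp u, whereas the
   factor exp u turns the normal weight of variance s^2 into that of variance
   2 s^2. *)
Lemma normal_pdf_expr6_le (s x : R) : 0 < s ->
  x ^+ 6 * normal_pdf 0 s x <=
  (1728 * Num.sqrt 2 * s ^+ 6) * normal_pdf 0 (Num.sqrt 2 * s) x.
Proof.
move=> s0; have s20 : 0 < Num.sqrt 2 * s by rewrite mulr_gt0.
rewrite !normal_pdfE ?gt_eqF// -normal_fun_sqrt2// normal_peak_sqrt2.
set u := x ^+ 2 / (4 * s ^+ 2).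
have u0 : 0 <= u by rewrite divr_ge0 ?sqr_ge0// mulr_ge0 ?sqr_ge0.
have -> : x ^+ 6 = 64 * s ^+ 6 * u ^+ 3 by rewrite /u; field; rewrite gt_eqF.
(* The constant in the claim: 1728 = 64 * 27, and sqrt 2 is the ratio of the two normal peaks. *)
set c := 64 * s ^+ 6 *
  (Num.sqrt 2 * normal_peak (Num.sqrt 2 * s) * normal_fun 0 s x).
have c0 : 0 <= c.
  by rewrite !mulr_ge0 ?normal_peak_ge0 ?normal_fun_ge0 ?exprn_ge0 ?sqrtr_ge0// ltW.
have := ler_wpM2l c0 (expR_ge_cube u0).
by apply: etrans; congr (_ <= _); rewrite /c; ring.
Qed.

Lemma integrable_normal_expr6 (s : R) : 0 < s ->
  lambda.-integrable setT (EFin \o (fun x => x ^+ 6 * normal_pdf 0 s x)).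
Proof.
move=> s0; set c := 1728 * Num.sqrt 2 * s ^+ 6.
have c0 : 0 <= c.
  apply: mulr_ge0; last by rewrite exprn_ge0// ltW.
  by apply: mulr_ge0; [rewrite ler0n|exact: sqrtr_ge0].
have ic := integrableZl (mu := lambda) measurableT c
  (integrable_normal_pdf 0 (Num.sqrt 2 * s)).
apply: le_integrable ic => //.
  apply/measurable_EFinP/measurable_funM; last exact: measurable_normal_pdf.
  exact: measurable_funX.
move=> x _; rewrite lee_fin !ger0_norm.
- exact: normal_pdf_expr6_le.
- by rewrite mulr_ge0// normal_pdf_ge0.
- by rewrite mulr_ge0 ?normal_pdf_ge0// (exprn_even_ge0 (n := 6)).
Qed.

(** Kept as an integral: an upper bound of order s^6 suffices to control the second moment of the
    statistic. *)
Definition normal_moment6 (s : R) : R :=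
  fine (\int[lambda]_x (x ^+ 6 * normal_pdf 0 s x)%:E)%E.

Lemma normal_moment6_le (s : R) : 0 < s ->
  normal_moment6 s <= 1728 * Num.sqrt 2 * s ^+ 6.
Proof.
move=> s0; rewrite -lee_fin fineK; last first.
  exact: (integrable_fin_num measurableT (integrable_normal_expr6 s0)).
rewrite -[leRHS]mule1 -(integral_normal_pdf 0 (Num.sqrt 2 * s)).
rewrite -integralZl//; last exact: integrable_normal_pdf.
apply: le_integral => //.
- exact: integrable_normal_expr6.
- apply: integrableZl => //; exact: integrable_normal_pdf.
- by move=> x _; rewrite lee_fin normal_pdf_expr6_le.
Qed.

(** Domination by x^6 + 1, since t <= t^2 + 1 for t = |x|^3. *)
Lemma integrable_normal_expr3 (s : R) : 0 < s ->
  lambda.-integrable setT (EFin \o (fun x => x ^+ 3 * normal_pdf 0 s x)).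
Proof.
move=> s0; have ic := integrableD (mu := lambda) measurableT
  (integrable_normal_expr6 s0) (integrable_normal_pdf 0 s).
apply: le_integrable ic => //.
  apply/measurable_EFinP/measurable_funM; last exact: measurable_normal_pdf.
  exact: measurable_funX.
move=> x _; rewrite -EFinD lee_fin normrM.
have p0 := normal_pdf_ge0 0 s x; set p := normal_pdf 0 s x in p0 *.
have x6 : x ^+ 6 = (`|x| ^+ 3) ^+ 2
  by rewrite -exprM -normrX ger0_norm// exprn_even_ge0.
have x3 : 0 <= `|x| ^+ 3 by exact: exprn_ge0.
rewrite (ger0_norm p0) normrX [leRHS]ger0_norm; last first.
  by rewrite addr_ge0// mulr_ge0// x6 sqr_ge0.
rewrite -[X in _ <= _ + X]mul1r -mulrDl ler_wpM2r// x6; nra.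
Qed.

(** The integrand is odd, so reflection shows that the integral equals its own negative; being
    finite, it vanishes. *)
Lemma integral_normal_expr3 (s : R) : 0 < s ->
  (\int[lambda]_x (x ^+ 3 * normal_pdf 0 s x)%:E = 0)%E.
Proof.
move=> s0; have i3 := integrable_normal_expr3 s0.
have := integral_lebesgue_oppr i3.
under eq_integral.
  move=> x _; rewrite (_ : _ * _ = - (x ^+ 3 * normal_pdf 0 s x)); last first.
    rewrite exprNn !normal_pdfE ?gt_eqF//= /normal_fun !subr0 sqrrN; ring.
  rewrite EFinN; over.
rewrite integralN/=; last first.
  by apply: integrable_add_def.
have := integrable_fin_num measurableT i3.
rewrite /=; case: (\int[lambda]_x _)%E => //= r _ [] rE.
by congr EFin; lra.
Qed.

End normal_moments.

Lemma has_mean_normal d (T : measurableType d) (R : realType)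
    (P : probability T R) (V : {RV P >-> R}) (s : R) : 0 < s ->
  (forall B, measurable B -> P (V @^-1` B) = normal_prob 0 s B) ->
  has_mean P (fun w => V w ^+ 3) 0 /\
  has_mean P (fun w => V w ^+ 6) (normal_moment6 s).
Proof.
move=> s0 VN.
have law f a := @has_mean_law _ T R P V (normal_pdf 0 s) f a
  (measurable_normal_pdf _ _) (normal_pdf_ge0 _ _) VN.
split.
  apply: (law (fun x => x ^+ 3)) => //.
  - exact: integrable_normal_expr3.
  - exact: integral_normal_expr3.
have i6 := integrable_normal_expr6 s0.
apply: (law (fun x => x ^+ 6)) => //.
by rewrite fineK//; exact: (integrable_fin_num measurableT i6).
Qed.

(** * Total variation distance and test functions *)

Section L1_distance.
Context d (T : measurableType d) (R : realType) (P Q : probability T R).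

(** By the Jordan decomposition nu+ - nu- of P - Q, the positive measures P + nu- and Q + nu+
    coincide. Integrating [f] against both, the two Jordan parts contribute between 0 and M l
    each. *)
Lemma L1_bounded_test (f : T -> R) (M l p q : R) : measurable_fun setT f ->
  (forall w, 0 <= f w <= M) -> (L1_distance P Q <= l%:E)%E ->
  has_mean P f p -> has_mean Q f q -> p <= q + M * l /\ q <= p + M * l.
Proof.
move=> mf fM; rewrite /L1_distance /total_variation_norm.
set nu := charge_sub P Q.
set pos := cid (Hahn_decomposition nu); set neg := cid (svalP pos).
move=> lel [_ fp] [_ fq].
have nuPN := svalP neg.
pose mpos : {measure set T -> \bar R} := jordan_pos nuPN.
pose mneg : {measure set T -> \bar R} := jordan_neg nuPN.
(* The variation norm unfolds to the sum of the masses of the two Jordan parts. *)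
have lel' : (mpos setT + mneg setT <= l%:E)%E by [].
have posl : (mpos setT <= l%:E)%E by apply: le_trans lel'; rewrite leeDl.
have negl : (mneg setT <= l%:E)%E by apply: le_trans lel'; rewrite leeDr.
have PQ A : measurable A -> (measure_add P mneg A = measure_add Q mpos A)%E.
  move=> mA; rewrite !measure_addE.
  have := jordan_decomp nuPN mA.
  rewrite /nu /charge_sub [in RHS]/cadd /= cscaleN1.
  rewrite [LHS](_ : _ = P A - Q A)%E//.
  rewrite -(fineK (fin_num_measure P _ mA)) -(fineK (fin_num_measure Q _ mA)).
  rewrite -(fineK (fin_num_measure (jordan_pos nuPN) _ mA)).
  rewrite -(fineK (fin_num_measure (jordan_neg nuPN) _ mA)).
  rewrite -!EFinD => -[PQA].
  have -> : (jordan_neg nuPN A = (fine (jordan_neg nuPN A))%:E)%E.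
    by rewrite fineK// fin_num_measure.
  by rewrite -EFinD; congr EFin; move: PQA; lra.
have M0 : 0 <= M.
  by have /andP[f0 fleM] := fM point; exact: le_trans f0 fleM.
have mf' : measurable_fun setT (EFin \o f) by exact/measurable_EFinP.
have f0 w : (0 <= (f w)%:E)%E by rewrite lee_fin; have /andP[] := fM w.
have small (m : {measure set T -> \bar R}) : (m setT <= l%:E)%E ->
    (\int[m]_w (f w)%:E <= (M * l)%:E)%E.
  move=> ml; apply: (@le_trans _ _ (\int[m]_w (cst M%:E w))%E).
    apply: ge0_le_integral => // w _; rewrite ?lee_fin//.
    by have /andP[] := fM w.
  by rewrite integral_cst// EFinM lee_wpmul2l.
have := @eq_measure_integral _ T R setT (measure_add Q mpos)
  (measure_add P mneg) (EFin \o f) (fun A mA _ => PQ A mA).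
rewrite !ge0_integral_measure_add//= fp fq.
have := small _ posl; have := small _ negl.
have : (0 <= \int[mpos]_w (f w)%:E)%E by exact: integral_ge0.
have : (0 <= \int[mneg]_w (f w)%:E)%E by exact: integral_ge0.
case: (\int[mpos]_w _)%E => [a| |]//; case: (\int[mneg]_w _)%E => [b| |]//.
by rewrite -!EFinD !lee_fin => ? ? ? ? [?]; split; lra.
Qed.

(** Truncating [f] to [-M, M] changes each mean by at most K/M, which gives 2K/M; the truncated
    function shifted by M has values in [0, 2M], which gives 2M l. *)
Lemma L1_second_moment_test (f : T -> R) (M K l p q p2 q2 : R) :
  measurable_fun setT f -> 0 < M -> (L1_distance P Q <= l%:E)%E ->
  has_mean P f p -> has_mean Q f q ->
  has_mean P (fun w => f w ^+ 2) p2 -> has_mean Q (fun w => f w ^+ 2) q2 ->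
  p2 <= K -> q2 <= K -> `|p - q| <= 2 * K / M + 2 * M * l.
Proof.
move=> mf M0 PQl fp fq fp2 fq2 p2K q2K.
pose clip w := Num.max (- M) (Num.min M (f w)).
have mclip : measurable_fun setT clip.
  by apply: measurable_maxr => //; exact: measurable_minr.
have clipM w : - M <= clip w <= M.
  by rewrite /clip le_max lexx/= ge_max ge_min lexx/= andbT; lra.
(* The error is zero unless |f| >= M, and then it is |f| - M <= |f| <= f^2 / M. *)
have clipf w : `|f w - clip w| <= M^-1 * f w ^+ 2.
  rewrite ler_pdivlMl// /clip.
  have [Mf|fM] := leP M (f w).
    by rewrite (max_idPr _) ?ger0_norm ?subr_ge0//; [nra|lra].
  have [fNM|Nfm] := leP (f w) (- M).
    by rewrite opprK ler0_norm; [nra|lra].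
  by rewrite subrr normr0 mulr0 sqr_ge0.
have clip_mean (m : probability T R) (a a2 : R) : has_mean m f a ->
    has_mean m (fun w => f w ^+ 2) a2 -> a2 <= K ->
    exists2 b, has_mean m clip b & `|a - b| <= K / M.
  move=> fa fa2 a2K.
  have [b clipb] : exists b, has_mean m clip b.
    apply/integrable_has_mean.
    have /= iM := finite_measure_integrable_cst m M measurableT.
    apply: (has_mean_dominated mclip iM) => w.
    by rewrite (ger0_norm (ltW M0)) ler_norml.
  exists b => //.
  have := has_meanZ M^-1 fa2; have := has_meanB fa clipb.
  move=> fab f2; rewrite ler_norml.
  have up := has_mean_le fab f2 (fun w => le_trans (ler_norm _) (clipf w)).
  have dn := has_mean_le (has_meanZ (-1) fab) f2 _.
  have {}dn : -1 * (a - b) <= M^-1 * a2.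
    apply: dn => w; rewrite mulN1r (le_trans _ (clipf w))//.
    by rewrite -normrN ler_norm.
  have Ma2 : M^-1 * a2 <= K / M by rewrite mulrC ler_wpM2r// invr_ge0 ltW.
  by apply/andP; split; lra.
have [p' clipp pp'] := clip_mean P p p2 fp fp2 p2K.
have [q' clipq qq'] := clip_mean Q q q2 fq fq2 q2K.
have clip0 w : 0 <= clip w + M <= 2 * M by have := clipM w; lra.
have mclip' : measurable_fun setT (fun w => clip w + M).
  exact: measurable_funD.
have [] := L1_bounded_test mclip' clip0 PQl
  (has_meanD clipp (has_mean_cst P M)) (has_meanD clipq (has_mean_cst Q M)).
move: pp' qq'; rewrite !ler_norml => /andP[? ?] /andP[? ?] ? ?.
by apply/andP; split; lra.
Qed.

End L1_distance.

(** * Moments of the sum of cubes for the chain and for the diffusion *)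

Lemma sigma_generated_sub d (T : measurableType d) (R : realType)
    (P : probability T R) (I : Type) (D : set I) (Z : I -> {RV P >-> R}) :
  \bigcup_(i in D) preimage_set_system setT (Z i) measurable `<=` @measurable _ T.
Proof. by move=> _ [i _ [B mB <-]]; exact: (measurable_funPT (Z i)). Qed.

Lemma adapted_generator d (T : measurableType d) (R : realType)
    (I : Type) (D : set I) (Z : I -> T -> R) i : D i ->
  adapted (\bigcup_(i in D) preimage_set_system setT (Z i) measurable) (Z i).
Proof.
move=> Di _ B mB; apply: sub_sigma_algebra; exists i => //.
by exists B.
Qed.

Lemma conditional_density_law d (T : measurableType d) (R : realType)
    (P : probability T R) (G : set (set T)) (xi : T -> R) (q : R -> R) :
  has_conditional_density P <<s G >> xi (fun=> q) ->
  forall B, measurable B ->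
    (P (xi @^-1` B) = \int[lebesgue_measure]_(y in B) (q y)%:E)%E.
Proof.
move=> cd B mB; rewrite -[LHS](_ : P (setT `&` xi @^-1` B) = _).
  2: by rewrite setTI.
rewrite cd//; last exact: (@measurableT _ (g_sigma_algebraType G)).
by rewrite [LHS]integral_cst//= [X in (_ * X)%E]probability_setT mule1.
Qed.

(** A conditional density that does not depend on w integrates over A to P A times the law of
    [xi]. *)
Lemma conditional_density_indep d (T : measurableType d) (R : realType)
    (P : probability T R) (G : set (set T)) (xi : T -> R) (q : R -> R) :
  G `<=` measurable ->
  has_conditional_density P <<s G >> xi (fun=> q) -> independent_of P G xi.
Proof.
move=> Gm cd A B GA mB; rewrite (conditional_density_law cd)// cd//.
have mA : measurable A.
  by move: GA; apply: smallest_sub => //; exact: sigma_algebra_measurable.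
by rewrite [LHS]integral_cst// muleC.
Qed.

(** Each centred increment is sqrt h times a walk of k innovations independent of the earlier
    increments, so the cubes are uncorrelated with a common mean [m]. *)
Lemma chain_moments d (T : measurableType d) (R : realType)
    (P : probability T R) (q : R -> R) (x0 h : R) (n k : nat)
    (X xi : nat -> {RV P >-> R}) (mu : nat -> R) :
  is_density q -> 0 < h -> is_chain q x0 h (n * k) X xi ->
  mu 0%N = 1 -> mu 1%N = 0 ->
  (forall i, (i <= 6)%N -> lebesgue_measure.-integrable setT
     (EFin \o (fun y => y ^+ i * q y))) ->
  (forall i, (i <= 6)%N ->
     (\int[lebesgue_measure]_y (y ^+ i * q y)%:E = (mu i)%:E)%E) ->
  let D i w := X (i.+1 * k)%N w - X (i * k)%N w - k%:R * h in
  let m := Num.sqrt h ^+ 3 * (k%:R * mu 3%N) in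
  has_mean P (fun w => \sum_(i < n) D i w ^+ 3) (n%:R * m) /\
  has_mean P (fun w => (\sum_(i < n) D i w ^+ 3) ^+ 2)
    (n%:R * (Num.sqrt h ^+ 6 * sum_moment mu k 6) + n%:R * (n%:R - 1) * m ^+ 2).
Proof.
move=> [mq q0 q1] h0 [X0 XS Xcd] mu0 mu1 qi qmu D m.
pose G l := \bigcup_(i in [set i | (i <= l)%N])
  preimage_set_system setT (X i : T -> R) measurable.
have Gm l : G l `<=` @measurable _ T by exact: sigma_generated_sub.
have GX l j : (j <= l)%N -> adapted (G l) (X j).
  by move=> jl; exact: (@adapted_generator _ _ _ _ _ (fun i => X i : T -> R) j).
have sh0 : Num.sqrt h != 0 by rewrite gt_eqF// sqrtr_gt0.
have GD l i : (i.+1 * k <= l)%N -> adapted (G l) (D i).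
  move=> il; apply: measurable_funB; last exact: measurable_cst.
  apply: measurable_funB; apply: GX => //.
  by rewrite (leq_trans _ il)// leq_mul2r leqnSn orbT.
(* Used with [U] = 1 for the moments of one block, and with [U] the sum of the earlier cubes for the
   cross terms. *)
have walk i (U : T -> R) u r : (i < n)%N -> (r <= 6)%N ->
    adapted (G (i * k)%N) U -> has_mean P U u ->
    has_mean P (fun w => U w * D i w ^+ r)
      (Num.sqrt h ^+ r * (u * sum_moment mu k r)).
  move=> iN r6 GU Uu.
  pose S m w := (X (i * k + m)%N w - X (i * k)%N w - m%:R * h) / Num.sqrt h.
  have ltN m' : (m' < k)%N -> (i * k + m' < n * k)%N.
    move=> mk; rewrite (@leq_trans (i.+1 * k))//; last by rewrite leq_mul2r iN orbT.
    by rewrite mulSn addnC ltn_add2r.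
  have := @has_mean_random_walk _ T R P k 6 (fun m => G (i * k + m)%N) S
    (fun m => xi (i * k + m).+1) mu U u.
  move=> /(_ _ _ _ _ _ _ _ Uu k r (leqnn k) r6) walk.
  rewrite (_ : (fun w => _) = fun w => Num.sqrt h ^+ r * (U w * S k w ^+ r)).
    apply: has_meanZ; apply: walk => //.
    (* The sigma-algebras increase, so a weight known at time i k stays known during the block. *)
    - move=> m'; apply: adapted_sub GU; rewrite /G.
      move=> A [j/= jik Aj]; apply: sub_sigma_algebra; exists j => //=.
      by rewrite (leq_trans jik)// leq_addr.
    - move=> m' m'k; apply: measurable_funM; last exact: measurable_cst.
      apply: measurable_funB; last exact: measurable_cst.
      by apply: measurable_funB; apply: GX => //; rewrite leq_addr.
    - move=> m' m'k; apply: conditional_density_indep => //.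
      exact/Xcd/ltN.
    - by move=> w; rewrite /S addn0 mul0r subrr subr0 mul0r.
    - move=> m' w m'k; rewrite /S addnS XS ?ltN// -natr1.
      by field.
    - move=> m' j m'k j6; apply: (has_mean_law mq q0
        (conditional_density_law (Xcd _ (ltN _ m'k))) (f := fun y => y ^+ j)) => //.
      + exact: qi.
      + exact: qmu.
  apply/funext => w; rewrite mulrCA -exprMn; congr (_ * _ ^+ _).
  by rewrite /S /D mulSn addnC; field.
have moment i r : (i < n)%N -> (r <= 6)%N ->
    has_mean P (fun w => D i w ^+ r) (Num.sqrt h ^+ r * sum_moment mu k r).
  move=> iN r6; have := walk i (cst 1) 1 r iN r6 _ (has_mean_cst P 1).
  rewrite mul1r; under eq_fun do rewrite mul1r.
  by apply; exact: measurable_cst.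
have m3 : Num.sqrt h ^+ 3 * sum_moment mu k 3 = m by rewrite sum_moment3.
apply: (@has_mean_uncorrelated_sum _ T R P n (fun i w => D i w ^+ 3))
  => [i iN|i iN|i v iN Vv].
- by rewrite -m3; exact: moment.
- by under eq_fun do rewrite -exprM; exact: moment.
- rewrite -m3 mulrCA; apply: walk => //.
  apply: measurable_sum => j; apply: measurable_funX; apply: GD.
  by rewrite leq_mul2r ltn_ord orbT.
Qed.

(** The moments are computed for the Wiener increments [V] and transferred to [D] almost surely. In
    [D], [x0] stands for the value at time 0, as in the statistic, which sees only the observations
    and [x0]. *)
Lemma diffusion_moments d (T : measurableType d) (R : realType)
    (P : probability T R) (x0 sigma h : R) (n k : nat)
    (W Y : R -> {RV P >-> R}) :
  0 < h -> (0 < k)%N -> is_wiener W -> is_diffusion x0 sigma W Y ->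
  let D i w := Y ((i.+1 * k)%N%:R * h) w -
    (if i is 0%N then x0 else Y ((i * k)%N%:R * h) w) - k%:R * h in
  has_mean P (fun w => \sum_(i < n) D i w ^+ 3) 0 /\
  has_mean P (fun w => (\sum_(i < n) D i w ^+ 3) ^+ 2)
    (n%:R * (sigma ^+ 6 * normal_moment6 (Num.sqrt (k%:R * h)))).
Proof.
move=> h0 k0 [W0 Wnormal Windep _] diff D.
pose t i : R := (i * k)%N%:R * h.
have t_ge0 i : 0 <= t i by rewrite mulr_ge0// ltW.
have tS i : t i.+1 - t i = k%:R * h by rewrite /t mulSn natrD; ring.
have kh0 : 0 < k%:R * h by rewrite mulr_gt0// ltr0n.
have t_lt i : t i < t i.+1 by rewrite -subr_gt0 tS.
pose V i w := W (t i.+1) w - W (t i) w.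
have mV i : measurable_fun setT (V i) by apply: measurable_funB.
pose V' i : {RV P >-> R} := mfun_Sub (mem_set (mV i)).
have Vnormal i B : measurable B ->
    P (V' i @^-1` B) = normal_prob 0 (Num.sqrt (k%:R * h)) B.
  by move=> mB; rewrite -(tS i); exact: (Wnormal (t i) (t i.+1) B).
have skh0 : 0 < Num.sqrt (k%:R * h) by rewrite sqrtr_gt0.
have V36 i := has_mean_normal skh0 (Vnormal i).
pose G s := \bigcup_(u in [set u | 0 <= u <= s])
  preimage_set_system setT (W u : T -> R) measurable.
have Gm s : G s `<=` @measurable _ T by exact: sigma_generated_sub.
have GW s u : 0 <= u <= s -> adapted (G s) (W u).
  by move=> us; exact: (@adapted_generator _ _ _ _ _ (fun u => W u : T -> R) u).
have indep i : independent_of P (G (t i)) (V' i).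
  by move=> A B GA mB; exact: Windep.
have GV i j : (j < i)%N -> adapted (G (t i)) (fun w => (sigma * V j w) ^+ 3).
  move=> ji; have tji : t j.+1 <= t i.
    by apply: ler_wpM2r; [exact: ltW|rewrite ler_nat leq_mul2r ji orbT].
  apply: measurable_funX; apply: measurable_funM; first exact: measurable_cst.
  apply: measurable_funB; apply: GW; first by rewrite t_ge0.
  by rewrite t_ge0 (le_trans (ltW (t_lt j))).
have m6E i : has_mean P (fun w => ((sigma * V i w) ^+ 3) ^+ 2)
    (sigma ^+ 6 * normal_moment6 (Num.sqrt (k%:R * h))).
  under eq_fun do rewrite -exprM exprMn.
  by apply: has_meanZ; exact: (V36 i).2.
have m3E i : has_mean P (fun w => (sigma * V i w) ^+ 3) 0.
  under eq_fun do rewrite exprMn.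
  by rewrite -(mulr0 (sigma ^+ 3)); apply: has_meanZ; exact: (V36 i).1.
have VZ i v : has_mean P (fun w => \sum_(j < i) (sigma * V j w) ^+ 3) v ->
    has_mean P (fun w => (\sum_(j < i) (sigma * V j w) ^+ 3) *
      (sigma * V i w) ^+ 3) (v * 0).
  move=> Vv; apply: (@has_meanM_adapted _ _ _ P (G (t i)) _ (V' i)
    (fun x => (sigma * x) ^+ 3)) => //.
  - by apply: measurable_sum => j; exact: GV.
  - by apply: measurable_funX; exact: measurable_funM.
  - exact: m3E.
have [sum_m sum_s] := @has_mean_uncorrelated_sum _ T R P n
  (fun i w => (sigma * V i w) ^+ 3) 0
  (sigma ^+ 6 * normal_moment6 (Num.sqrt (k%:R * h)))
  (fun i _ => m3E i) (fun i _ => m6E i) (fun i v _ => @VZ i v).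
(* One null set serves all i, because the diffusion equation holds off a null set for all times at
   once. *)
have DV : {ae P, forall w, forall i, sigma * V i w = D i w}.
  move: W0 diff; apply: filterS2 => w W0w Yw i.
  rewrite /V /D Yw ?t_ge0//.
  case: i => [|i].
    rewrite /t mul0n mul0r W0w mulSn addn0; ring.
  rewrite Yw ?t_ge0// -/(t i.+1) -/(t i.+2).
  have := tS i.+1; move: (t i.+1) (t i.+2) => a b ab.
  have -> : b = k%:R * h + a by rewrite -ab; ring.
  ring.
have mD i : measurable_fun setT (D i).
  apply: measurable_funB => //; apply: measurable_funB => //.
  by case: i.
split.
- rewrite mulr0 in sum_m; apply: has_mean_ae sum_m.
    by apply: measurable_sum => i; exact: measurable_funX.
  move: DV; apply: filterS => w DV; apply: eq_bigr => i _; by rewrite DV.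
- rewrite expr0n mulr0 addr0 in sum_s; apply: has_mean_ae sum_s.
    apply: measurable_funX; apply: measurable_sum => i; exact: measurable_funX.
  move: DV; apply: filterS => w DV; congr (_ ^+ 2).
  by apply: eq_bigr => i _; rewrite DV.
Qed.

(** * The test statistic and the final contradiction *)

(** [a] centres the increments and [b] normalises. Prefixing [x0] to the observations makes it the
    predecessor of the first one. *)
Definition cubic_statistic (R : realType) (x0 a b : R) (n : nat)
    (x : n.-tuple R) : R :=
  b * \sum_(i < n) (nth x0 x i - nth x0 (x0 :: x) i - a) ^+ 3.

Lemma measurable_cubic_statistic (R : realType) (x0 a b : R) (n : nat) :
  measurable_fun setT (@cubic_statistic R x0 a b n).
Proof.
have mnth j : (j < n)%N -> measurable_fun setT (fun x : n.-tuple R => nth x0 x j).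
  move=> jn; rewrite (_ : (fun x => _) = fun x : n.-tuple R => tnth x (Ordinal jn)).
    exact: measurable_tnth.
  by apply/funext => x; rewrite (tnth_nth x0).
apply: measurable_funM; first exact: measurable_cst.
apply: measurable_sum => i; apply: measurable_funX; apply: measurable_funB.
  apply: measurable_funB; first exact: mnth.
  case: i => -[|i] /= iN; first exact: measurable_cst.
  by apply: mnth; exact: ltnW.
exact: measurable_cst.
Qed.

Lemma cubic_statisticE d (T : measurableType d) (R : realType)
    (P : probability T R) (x0 a b : R) (n : nat) (Z : 'I_n -> {RV P >-> R})
    (V : nat -> R) (w : T) :
  V 0%N = x0 -> (forall i : 'I_n, Z i w = V i.+1) ->
  cubic_statistic x0 a b (rv_tuple Z w) =
  b * \sum_(i < n) (V i.+1 - V i - a) ^+ 3.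
Proof.
move=> V0 ZV; rewrite /cubic_statistic; congr (_ * _); apply: eq_bigr => i _.
have nthZ j : (j < n)%N -> nth x0 (rv_tuple Z w) j = V j.+1.
  move=> jn; rewrite -[j]/(nat_of_ord (Ordinal jn)) -tnth_nth tnth_mktuple.
  exact: ZV.
rewrite nthZ//; case: i => -[|i] /= iN; first by rewrite V0.
by rewrite nthZ// ltnW.
Qed.

(** From |y|^i <= 1 + |y|^S and q <= psi, the integrand is dominated by q + |y|^S psi. *)
Lemma integrable_moment (R : realType) (q psi : R -> R) (S i : nat) :
  is_density q -> (i <= S)%N ->
  lebesgue_measure.-integrable setT (EFin \o (fun y => `|y| ^+ S * psi y)) ->
  (forall y, q y <= psi y) ->
  lebesgue_measure.-integrable setT (EFin \o (fun y => y ^+ i * q y)).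
Proof.
move=> [mq q0 q1] iS ipsi qpsi.
have iq : lebesgue_measure.-integrable setT (EFin \o q).
  apply/integrableP; split; first exact/measurable_EFinP.
  under eq_integral do rewrite /= ger0_norm//.
  by rewrite q1 ltry.
have isum := integrableD (mu := lebesgue_measure) measurableT iq ipsi.
apply: le_integrable isum => //.
  by apply/measurable_EFinP/measurable_funM => //; exact: measurable_funX.
move=> y _; rewrite -EFinD lee_fin normrM normrX (ger0_norm (q0 y)).
have yS : 0 <= `|y| ^+ S by exact: exprn_ge0.
have psi0 : 0 <= psi y by exact: le_trans (qpsi y).
rewrite [leRHS]ger0_norm; last by rewrite addr_ge0// mulr_ge0.
apply: (@le_trans _ _ ((1 + `|y| ^+ S) * q y)); last first.
  by rewrite mulrDl mul1r lerD2l ler_wpM2l.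
rewrite ler_wpM2r//; have [y1|y1] := leP `|y| 1.
  by rewrite (@le_trans _ _ 1) ?exprn_ile1// lerDl.
by rewrite (@le_trans _ _ (`|y| ^+ S)) ?ler_weXn2l ?lerDr// ltW.
Qed.

Theorem theorem3 (R : realType) (q : R -> R) (x0 sigma mu3 : R)
  (h : nat -> R) (k : nat -> nat) (c : R)
  (* the Markov chains, one for each n *)
  (d : nat -> measure_display) (T : forall n : nat, measurableType (d n))
  (P : forall n : nat, probability (T n) R)
  (X xi : forall n : nat, nat -> {RV (P n) >-> R})
  (* the Wiener process and the diffusion *)
  (dW : measure_display) (TW : measurableType dW) (PW : probability TW R)
  (W Y : R -> {RV PW >-> R})
  (q_density : is_density q)
  (sigma_def : (\int[lebesgue_measure]_y (y ^+ 2 * q y)%:E = (sigma ^+ 2)%:E)%E)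
  (sigma_gt0 : 0 < sigma)
  (mu3_def : (\int[lebesgue_measure]_y (y ^+ 3 * q y)%:E = mu3%:E)%E)
  (h_gt0 : forall n : nat, (0 < n)%N -> 0 < h n)
  (k_gt0 : forall n : nat, (0 < n)%N -> (0 < k n)%N)
  (h_cvg0 : h n @[n --> \oo] --> (0 : R))
  (* (i) *)
  (q_centered : (\int[lebesgue_measure]_y (y * q y)%:E = 0)%E)
  (* (ii) *)
  (sigma_bounds : exists sigma_lo sigma_hi : R,
    [/\ 0 < sigma_lo, 0 < sigma_hi & sigma_lo <= sigma ^+ 2 <= sigma_hi])
  (* (iii) *)
  (q_smooth : exists (S' : nat) (psi : R -> R),
    [/\ [/\ (1 < S')%N, (forall y : R, 0 <= psi y), has_ubound (range psi) &
            lebesgue_measure.-integrable setT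
              (fun y : R => (`|y| ^+ (2 * S' + 4) * psi y)%:E)],
        (forall (nu : nat) (y : R), (nu < 4)%N -> derivable (derive1n nu q) y 1),
        (forall (nu : nat) (y : R), (nu <= 4)%N -> `|derive1n nu q y| <= psi y) &
        exists C : R, forall (j : nat) (y : R), (1 <= j)%N ->
          `|conv_power q j y|
            <= C * (j%:R `^ (- 2^-1)) * psi (j%:R `^ (- 2^-1) * y)])
  (* (iv) *)
  (hk_bounds : exists kappa C : R,
    [/\ kappa < 5^-1, 0 < C & forall n : nat, (0 < n)%N ->
        C^-1 * ((k n)%:R `^ (- kappa)) < h n * (k n)%:R < C])
  (nk_cvg : (n%:R / (k n)%:R : R) @[n --> \oo] --> c)
  (c_neq0 : c != 0)
  (mu3_neq0 : mu3 != 0)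
  (kh_cvg0 : (k n)%:R * h n @[n --> \oo] --> (0 : R))
  (X_chain : forall n : nat, (0 < n)%N ->
    is_chain q x0 (h n) (n * k n) (X n) (xi n))
  (W_wiener : is_wiener W)
  (Y_diffusion : is_diffusion x0 sigma W Y) :
  let P_h (n : nat) := joint_law (fun i : 'I_n => X n (i.+1 * k n)%N) in
  let Q_h (n : nat) :=
    joint_law (fun i : 'I_n => Y ((i.+1 * k n)%N%:R * h n)) in
  ~ (L1_distance (P_h n) (Q_h n) @[n --> \oo] --> (0 : \bar R)).
Proof.
move=> P_h Q_h L1_cvg0.
have [S' [psi [[S'1 psi0 _ ipsi] _ qpsi _]]] := q_smooth.
have [mq q0 q1] := q_density.
have iq i : (i <= 6)%N -> lebesgue_measure.-integrable setT
    (EFin \o (fun y => y ^+ i * q y)).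
  move=> i6; apply: (integrable_moment q_density _ ipsi).
    (* S' > 1 gives 2 S' + 4 >= 8, which covers the sixth moment. *)
    by rewrite (leq_trans i6)//; lia.
  by move=> y; have := qpsi 0%N y isT; rewrite derive1n0 (ger0_norm (q0 y)).
pose mu i := fine (\int[lebesgue_measure]_y (y ^+ i * q y)%:E)%E.
have qmu i : (i <= 6)%N ->
    (\int[lebesgue_measure]_y (y ^+ i * q y)%:E = (mu i)%:E)%E.
  by move=> i6; rewrite fineK//; exact: (integrable_fin_num measurableT (iq _ i6)).
have mu0 : mu 0%N = 1.
  rewrite /mu; under eq_integral do rewrite expr0 mul1r.
  by rewrite q1.
have mu1 : mu 1%N = 0.
  rewrite /mu; under eq_integral do rewrite expr1.
  by rewrite q_centered.
have mu3E : mu 3%N = mu3 by rewrite /mu mu3_def.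
pose r n : R := n%:R / (k n)%:R.
have r_ge0 n : 0 <= r n by rewrite divr_ge0.
have c_gt0 : 0 < c.
  rewrite lt_neqAle eq_sym c_neq0/=.
  by apply: (cvgr_to_ge nk_cvg); exact: nearW.
pose C1 := `|mu 6| + 15 * `|mu 4 * mu 2| + 10 * mu 3 ^+ 2 + 15 * `|mu 2 ^+ 3|.
pose C2 := sigma ^+ 6 * (1728 * Num.sqrt 2).
(* A common bound for both second moments: [C1] for the sixth moments of the chain, [C2] for those
   of the diffusion, and the last term for the squared mean under the chain once n/k < 2c. *)
pose K := C1 + C2 + 2 * c * mu3 ^+ 2.
have C1_ge0 : 0 <= C1.
  by rewrite /C1 !addr_ge0// mulr_ge0// sqr_ge0.
have C2_ge0 : 0 <= C2.
  apply: mulr_ge0; first by rewrite exprn_ge0// ltW.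
  by apply: mulr_ge0; [rewrite ler0n|exact: sqrtr_ge0].
have mu3sq : 0 < mu3 ^+ 2 by rewrite exprn_even_gt0.
have cmu3 : 0 < c * mu3 ^+ 2 by rewrite mulr_gt0.
have K_gt0 : 0 < K by rewrite /K -mulrA; lra.
(* A lower bound for the mean of the statistic in absolute value once n/k > c/2. *)
pose a := Num.sqrt (c / 2) * `|mu3|.
have a_gt0 : 0 < a by rewrite mulr_gt0 ?normr_gt0// sqrtr_gt0 divr_gt0.
have a2 : a ^+ 2 = c / 2 * mu3 ^+ 2.
  by rewrite exprMn sqr_sqrtr ?divr_ge0 ?(ltW c_gt0)// real_normK ?num_real.
(* [M] and [l] are chosen to make 2K/M and 2M l both equal to a/4. *)
pose M := 8 * K / a.
have M_gt0 : 0 < M by rewrite divr_gt0// mulr_gt0.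
pose l := a / (8 * M).
have l_gt0 : 0 < l by rewrite divr_gt0// mulr_gt0.
have [L1_fin L1_fine] := (fine_cvgP _ _).1 L1_cvg0.
have L1_lt : \forall n \near \oo, fine (L1_distance (P_h n) (Q_h n)) < l.
  exact: cvgr_lt L1_fine _ l_gt0.
have c2 : c / 2 < c by lra.
have c2' : c < 2 * c by lra.
have r_gt : \forall n \near \oo, c / 2 < r n by exact: cvgr_gt nk_cvg _ c2.
have r_lt : \forall n \near \oo, r n < 2 * c by exact: cvgr_lt nk_cvg _ c2'.
have : \forall n \near \oo, [/\ L1_distance (P_h n) (Q_h n) \is a fin_num,
    fine (L1_distance (P_h n) (Q_h n)) < l, c / 2 < r n, r n < 2 * c & (0 < n)%N].
  by near=> n; split; near: n => //; exact: nbhs_infty_gt.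
(* A single n with all these properties suffices for the contradiction. *)
move=> /filter_ex[n [L1n L1nl rn_gt rn_lt n0]].
have k0 := k_gt0 n n0; have h0 := h_gt0 n n0.
have nR0 : (0 : R) < n%:R by rewrite ltr0n.
have kR0 : (0 : R) < (k n)%:R by rewrite ltr0n.
pose b := (Num.sqrt (n%:R * (k n)%:R ^+ 3 * h n ^+ 3))^-1.
have b2 : b ^+ 2 = (n%:R * (k n)%:R ^+ 3 * h n ^+ 3)^-1.
  by rewrite exprVn sqr_sqrtr// !mulr_ge0// ?exprn_ge0// ltW.
have b2_ge0 : 0 <= b ^+ 2 by exact: sqr_ge0.
pose t : n.-tuple R -> R := @cubic_statistic R x0 ((k n)%:R * h n) b n.
have mt : measurable_fun setT t by exact: measurable_cubic_statistic.
have mt2 : measurable_fun setT (fun x => t x ^+ 2) by exact: measurable_funX.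
have sh2 : Num.sqrt (h n) ^+ 2 = h n by rewrite sqr_sqrtr// ltW.
have sh6 : Num.sqrt (h n) ^+ 6 = h n ^+ 3 by rewrite (exprM _ 2 3) sh2.
have L1l : (L1_distance (P_h n) (Q_h n) <= l%:E)%E.
  by rewrite -(fineK L1n) lee_fin ltW.
have [Pm Ps] := chain_moments q_density h0 (X_chain n n0) mu0 mu1 iq qmu.
rewrite mu3E in Pm Ps.
have tP w : t (rv_tuple (fun i : 'I_n => X n (i.+1 * k n)%N) w) =
    b * \sum_(i < n) (X n (i.+1 * k n)%N w - X n (i * k n)%N w
      - (k n)%:R * h n) ^+ 3.
  rewrite /t (@cubic_statisticE _ _ _ _ _ _ _ _ _ (fun i => X n (i * k n)%N w))//.
  by have [X0 _ _] := X_chain n n0; rewrite mul0n X0.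
have toP f v : measurable_fun setT f ->
    has_mean (P n)
      (fun w => f (rv_tuple (fun i : 'I_n => X n (i.+1 * k n)%N) w)) v ->
    has_mean (P_h n) f v.
  by move=> mf ?; exact: (has_mean_distribution _ v mf).2.
have := has_meanZ b Pm; under eq_fun do rewrite -tP.
move=> /(toP _ _ mt) Pt.
have := has_meanZ (b ^+ 2) Ps; under eq_fun do rewrite -exprMn -tP.
move=> /(toP _ _ mt2) Pt2.
have [Qm Qs] := diffusion_moments n h0 k0 W_wiener Y_diffusion.
have tQ w : t (rv_tuple (fun i : 'I_n => Y ((i.+1 * k n)%N%:R * h n)) w) =
    b * \sum_(i < n) (Y ((i.+1 * k n)%N%:R * h n) w -
      (if (i : nat) is 0%N then x0 else Y ((i * k n)%N%:R * h n) w)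
      - (k n)%:R * h n) ^+ 3.
  rewrite /t (@cubic_statisticE _ _ _ _ _ _ _ _ _
    (fun i => if i is 0%N then x0 else Y ((i * k n)%N%:R * h n) w))//.
have toQ f v : measurable_fun setT f ->
    has_mean PW
      (fun w => f (rv_tuple (fun i : 'I_n => Y ((i.+1 * k n)%N%:R * h n)) w)) v ->
    has_mean (Q_h n) f v.
  by move=> mf ?; exact: (has_mean_distribution _ v mf).2.
have := has_meanZ b Qm; under eq_fun do rewrite -tQ.
move=> /(toQ _ _ mt) Qt.
have := has_meanZ (b ^+ 2) Qs; under eq_fun do rewrite -exprMn -tQ.
move=> /(toQ _ _ mt2) Qt2.
have := L1_second_moment_test (K := K) mt M_gt0 L1l Pt Qt Pt2 Qt2.
rewrite mulr0 subr0.
set p := b * _; set p2 := b ^+ 2 * _; set q2 := b ^+ 2 * _.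
(* Squaring removes the roots in [b] and sqrt h; the powers of h cancel and n/k remains. *)
have pE : p ^+ 2 = r n * mu3 ^+ 2.
  rewrite /p !exprMn b2 !sh2 /r.
  by field; rewrite !gt_eqF.
have p2K : p2 <= K.
  have -> : p2 = b ^+ 2 * (n%:R * (h n ^+ 3 * sum_moment mu (k n) 6))
      + p ^+ 2 - b ^+ 2 * n%:R * (Num.sqrt (h n) ^+ 3 * ((k n)%:R * mu3)) ^+ 2.
    by rewrite /p2 /p sh6; ring.
  have a6 : b ^+ 2 * (n%:R * (h n ^+ 3 * sum_moment mu (k n) 6)) <= C1.
    rewrite [leRHS](_ : _ =
        b ^+ 2 * (n%:R * (h n ^+ 3 * (C1 * (k n)%:R ^+ 3)))); last first.
      by rewrite b2; field; rewrite !gt_eqF.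
    do 3 (apply: ler_wpM2l => //); first by rewrite exprn_ge0// ltW.
    exact: sum_moment6_le.
  have rest : 0 <= b ^+ 2 * n%:R *
      (Num.sqrt (h n) ^+ 3 * ((k n)%:R * mu3)) ^+ 2.
    by rewrite mulr_ge0 ?sqr_ge0// mulr_ge0.
  have rK : r n * mu3 ^+ 2 <= 2 * c * mu3 ^+ 2 by rewrite ler_pM2r// ltW.
  rewrite pE /K; lra.
have q2K : q2 <= K.
  have kh0 : 0 < (k n)%:R * h n by rewrite mulr_gt0.
  have q2C : q2 <= C2.
    rewrite [leRHS](_ : _ = b ^+ 2 * (n%:R * (sigma ^+ 6 *
      (1728 * Num.sqrt 2 * Num.sqrt ((k n)%:R * h n) ^+ 6)))); last first.
      rewrite (exprM (Num.sqrt (_ * _)) 2 3) sqr_sqrtr ?(ltW kh0)// b2 /C2.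
      by move: (1728 * _) => C2'; field; rewrite !gt_eqF.
    do 3 (apply: ler_wpM2l => //); first by rewrite exprn_ge0// ltW.
    by apply: normal_moment6_le; rewrite sqrtr_gt0.
  by rewrite (le_trans q2C)// /K -mulrA; lra.
move=> /(_ p2K q2K).
have ap : a <= `|p|.
  rewrite -(@ler_pXn2r _ 2)// ?nnegrE ?(ltW a_gt0)// real_normK ?num_real//.
  by rewrite a2 pE ler_pM2r// ltW.
have -> : 2 * K / M = a / 4.
  by rewrite /M; field; rewrite !gt_eqF.
have -> : 2 * M * l = a / 4.
  by rewrite /l; field; rewrite gt_eqF.
(* Now a <= |p| <= a/4 + a/4, against a > 0. *)
move=> pa; have := le_trans ap pa; lra.
Unshelve. all: by end_near. Qed.
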